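(* There is no ultrafilter $p\in\beta\mathbb{N}\setminus\mathbb{N}$ that is both multiplicatively idempotent and $E_2$-idempotent; that is, there is no $p\in\beta\mathbb{N}\setminus\mathbb{N}$ such that $p\odot p=p$ and $E_2(p,p)=p$.
   Context: $\mathbb{N}=\{1,2,\ldots\}$, and $\beta\mathbb{N}$ is the set of ultrafilters on $\mathbb{N}$; each $n\in\mathbb{N}$ is identified with the principal ultrafilter it generates, so $\beta\mathbb{N}\setminus\mathbb{N}$ is the set of nonprincipal ultrafilters. For $p,q\in\beta\mathbb{N}$ and $A\subseteq\mathbb{N}$: $$A\in p\odot q\iff\{n\in\mathbb{N}\mid\{m\in\mathbb{N}\mid nm\in A\}\in q\}\in p,$$ $$A\in E_2(p,q)\iff\{n\in\mathbb{N}\mid\{m\in\mathbb{N}\mid m^n\in A\}\in q\}\in p.$$ *)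

(* Defs.v *)
From mathcomp Require Import all_boot.
From mathcomp Require Import boolp classical_sets filter.

Set Implicit Arguments.
Unset Strict Implicit.
Unset Printing Implicit Defensive.

Local Open Scope classical_set_scope.

(* The positive integers {1, 2, 3, ...}: 0 is excluded. *)
Definition posN : Type := {n : nat | 0 < n}.

Lemma posN_mul_gt0 (n m : posN) : 0 < sval n * sval m.
Proof. by rewrite muln_gt0 (svalP n) (svalP m). Qed.

Lemma posN_exp_gt0 (m n : posN) : 0 < sval m ^ sval n.
Proof. by rewrite expn_gt0 (svalP m). Qed.

Definition posN_mul (n m : posN) : posN :=
  exist (fun k : nat => 0 < k) (sval n * sval m) (posN_mul_gt0 n m).

Definition posN_exp (m n : posN) : posN :=
  exist (fun k : nat => 0 < k) (sval m ^ sval n) (posN_exp_gt0 m n).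

Definition betaN : set (set_system posN) := [set p | UltraFilter p].

(* The copy of the positive integers inside [betaN]. *)
Definition principalN : set (set_system posN) :=
  range (@principal_filter posN).

Definition odot (p q : set_system posN) : set_system posN :=
  [set A | p [set n | q [set m | A (posN_mul n m)]]].

(* The outer variable [n] is the exponent, the inner variable [m] the base. *)
Definition E2 (p q : set_system posN) : set_system posN :=
  [set A | p [set n | q [set m | A (posN_exp m n)]]].

(* Main.v *)
Require Import Defs.
From mathcomp Require Import all_boot.
From mathcomp Require Import boolp classical_sets filter.

Local Open Scope classical_set_scope.

(** Let [u] be the image of [p] under [Omega], the number of prime factors
    counted with multiplicity. As [Omega (n * m) = Omega n + Omega m] and
    [Omega (m ^ n) = n * Omega m], the hypotheses give [u + u = u] and
    [p * u = u]. A [u]-generic [x] is a sum [n1 + n2] with [n2] divisible by a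
    power of 2 far beyond [n1], so its 2-part is that of [n1] and
    its binary length that of [n2]: the binary length of [x] therefore lies in
    the residue class preferred by [u] modulo the 2-part of [x]. A [u]-generic
    [x] is also a product [k * m] with [k] small and [m] highly divisible by 2;
    comparing [m] with [k * m], the binary lengths are congruent modulo the
    2-part of [m], although they differ by a positive amount bounded in terms
    of [k] alone. *)

(** Both [b] and the next power of 2 above it are multiples of a power of 2 exceeding [a], so adding
    [a] cannot bridge the gap between them. *)
Lemma trunc_log2_add (a b : nat) :
  0 < b -> 2 ^ (trunc_log 2 a).+1 %| b -> trunc_log 2 (a + b) = trunc_log 2 b.
Proof.
move=> b_gt0 dvd_b; apply: trunc_log_eq => //.
have lt_a := trunc_log_ltn a (isT : 1 < 2).
have le_lb := trunc_log_max (isT : 1 < 2) (dvdn_leq b_gt0 dvd_b).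
have /andP[le_b lt_b] := trunc_log_bounds (isT : 1 < 2) b_gt0.
rewrite (leq_trans le_b (leq_addl _ _)) /=.
have /dvdnP[s def_s] := dvdn_exp2l 2 (leqW le_lb).
case/dvdnP: dvd_b => t def_b; set d := 2 ^ _ in lt_a def_s def_b.
move: lt_b; rewrite def_s {1}def_b ltn_pmul2r ?expn_gt0 // => lt_ts.
apply: (@leq_trans (t.+1 * d)); last by rewrite leq_mul2r lt_ts orbT.
by rewrite mulSn def_b ltn_add2r.
Qed.

(** Since [b] is a multiple of twice the 2-part of [a], dividing the sum by that 2-part leaves odd
    plus even. *)
Lemma partn2_add (a b : nat) :
  0 < a -> 2 ^ (trunc_log 2 a).+1 %| b -> (a + b)`_2 = a`_2.
Proof.
move=> a_gt0 dvd_b.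
have odd_o : odd a`_2^'.
  by have := part_pnat 2^' a; rewrite p'natE // dvdn2 negbK.
have /dvdnP[t ->] : a`_2 * 2 %| b.
  apply: dvdn_trans dvd_b; rewrite p_part -expnSr dvdn_exp2l // ltnS.
  by apply: trunc_log_max; rewrite // -p_part dvdn_leq ?dvdn_part.
rewrite -{1}(partnC 2 a_gt0) (mulnC t) -mulnA -mulnDr.
rewrite partnM ?part_gt0 ?addn_gt0 ?part_gt0 // part_pnat_id ?part_pnat //.
rewrite [X in _ * X]part_p'nat ?muln1 //.
by rewrite p'natE // dvdn2 negbK oddD odd_o oddM.
Qed.

Lemma trunc_log2_mul (k m : nat) : 0 < k -> 0 < m ->
  trunc_log 2 k + trunc_log 2 m <= trunc_log 2 (k * m)
    <= (trunc_log 2 k + trunc_log 2 m).+1.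
Proof.
move=> k_gt0 m_gt0.
have /andP[lek ltk] := trunc_log_bounds (isT : 1 < 2) k_gt0.
have /andP[lem ltm] := trunc_log_bounds (isT : 1 < 2) m_gt0.
rewrite trunc_log_max ?expnD ?leq_mul //= -ltnS -(ltn_exp2l (m := 2)) //.
apply: (@leq_ltn_trans (k * m)); first by rewrite trunc_logP ?muln_gt0 ?k_gt0.
by rewrite -addSn -addnS expnD ltn_mul.
Qed.

Section NatUltrafilter.

Variables (u : set_system nat).
Hypotheses (uF : ProperFilter u) (u_ultra : forall A, u A \/ u (~` A)).

Lemma ultra_pigeonhole (g : nat -> nat) (n : nat) :
  u [set x | g x < n] -> exists r, u [set x | g x = r].
Proof.
elim: n => [|n IHn] u_lt; first by have [x] := filter_ex u_lt.
have [u_eq | u_ne] := u_ultra [set x | g x = n]; first by exists n.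
apply: IHn; apply: filterS (filterI u_lt u_ne) => x /= [le_gx ne_gx].
by rewrite ltn_neqAle -ltnS le_gx andbT; apply/eqP.
Qed.

Lemma ultra_modn (g : nat -> nat) (d : nat) :
  0 < d -> exists r, u [set x | g x = r %[mod d]].
Proof.
move=> d_gt0; have [|r u_r] := @ultra_pigeonhole (fun x => g x %% d) d.
  by apply: filterE => x /=; rewrite ltn_mod.
by exists r; apply: filterS u_r => y /= <-; rewrite modn_mod.
Qed.

Hypothesis u_add : forall A, u A -> u [set n | u [set m | A (n + m)]].

(** The residue [r] preferred by [u] modulo [d] satisfies [r + r = r], hence is zero. *)
Lemma add_idem_dvdn (d : nat) : 0 < d -> u [set x | d %| x].
Proof.
move=> d_gt0; have [r u_r] := @ultra_modn id d d_gt0.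
have [n /= [n_r u_n]] := filter_ex (filterI u_r (u_add _ u_r)).
have [m /= [m_r nm_r]] := filter_ex (filterI u_r u_n).
apply: filterS u_r => x /= x_r.
suff: m + n == m %[mod d].
  by rewrite -{2}[m]addn0 eqn_modDl mod0n n_r -x_r.
by rewrite addnC; apply/eqP; rewrite nm_r m_r.
Qed.

Hypothesis u_gt0 : u [set x | 0 < x].

Lemma trunc_log2_mod_partn2 :
  u [set x | u [set y | trunc_log 2 y = trunc_log 2 x %[mod x`_2]]].
Proof.
set Q := [set x | _].
have [//|u_nQ] := u_ultra Q.
have [a /= [a_gt0 u_a]] := filter_ex (filterI u_gt0 (u_add _ u_nQ)).
have [r u_r] := @ultra_modn (trunc_log 2) _ (part_gt0 2 a).
have dvd_u := @add_idem_dvdn (2 ^ (trunc_log 2 a).+1) (expn_gt0 _ _).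
(* For such [b], the sum [a + b] has the 2-part of [a] and the binary length of [b], whose class
   modulo that 2-part is the preferred [r]; this puts [a + b] in [Q]. *)
have [b /= [[nQ_ab b_r] [b_gt0 dvd_b]]] :=
  filter_ex (filterI (filterI u_a u_r) (filterI u_gt0 dvd_u)).
case: nQ_ab; rewrite /Q /= partn2_add // trunc_log2_add //.
by apply: filterS u_r => y /= ->.
Qed.

(** The multiplier has its own filter [p], because in [Omega (m ^ n) = n * Omega m] the exponent
    enters as itself and not through [Omega]. *)
Lemma no_mul_absorbing_add_idem (T : Type) (p : set_system T) (f : T -> nat) :
  ProperFilter p -> p [set k | 1 < f k] ->
  ~ forall A, u A -> p [set k | u [set m | A (f k * m)]].
Proof.
move=> pF p_gt1 u_mul.
have [t /= [k_gt1 u_t]] :=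
  filter_ex (filterI p_gt1 (u_mul _ trunc_log2_mod_partn2)).
set k := f t in k_gt1 u_t.
have dvd_u := @add_idem_dvdn (2 ^ (trunc_log 2 k).+1) (expn_gt0 _ _).
have [m /= [[u_m u_km] [m_gt0 dvd_m]]] := filter_ex
  (filterI (filterI trunc_log2_mod_partn2 u_t) (filterI u_gt0 dvd_u)).
(* The common [y] links the length of [m] to that of [k * m]. *)
have [y /= [y_m y_km]] := filter_ex (filterI u_m u_km).
have k_gt0 := ltnW k_gt1.
have lk_gt0 : 0 < trunc_log 2 k by rewrite trunc_log_gt0.
have /andP[le_l le_r] := trunc_log2_mul _ _ k_gt0 m_gt0.
have lm_km : trunc_log 2 m = trunc_log 2 (k * m) %[mod m`_2].
  have dvd_2 : m`_2 %| (k * m)`_2 by rewrite partnM ?dvdn_mull.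
  by rewrite -y_m -(modn_dvdm _ dvd_2) y_km modn_dvdm.
have lt_lm : trunc_log 2 m < trunc_log 2 (k * m).
  by apply: leq_trans le_l; rewrite -[ltnLHS]add0n ltn_add2r.
(* The difference is a positive multiple of the 2-part of [m], yet at most [(trunc_log 2 k).+1]. *)
have le_m2 : m`_2 <= trunc_log 2 (k * m) - trunc_log 2 m.
  by rewrite dvdn_leq ?subn_gt0 // -eqn_mod_dvd ?lm_km // ltnW.
have lt_m2 : (trunc_log 2 k).+1 < m`_2.
  apply: leq_trans (ltn_expl _ (isT : 1 < 2)) _.
  by rewrite p_part leq_exp2l // -pfactor_dvdn.
have := leq_trans lt_m2 le_m2.
by rewrite ltn_subRL addnC addSn ltnNge le_r.
Qed.

End NatUltrafilter.

(** No primality filter is needed: [logn q n] is 0 for [q] not prime. *)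
Definition bigOmega (n : nat) : nat := \sum_(q < n.+1) logn q n.

(** A common summation range lets the sums for [n], [m] and [n * m] be compared term by term. *)
Lemma bigOmega_widen (n N : nat) :
  0 < n <= N -> bigOmega n = \sum_(q < N.+1) logn q n.
Proof.
move=> /andP[n_gt0 le_nN].
rewrite /bigOmega (big_ord_widen N.+1 (fun q => logn q n)) //.
rewrite big_mkcond; apply: eq_bigr => q _; case: ifPn => //.
rewrite -leqNgt => lt_nq; rewrite lognE n_gt0 /=; case: ifP => // /andP[_].
by move/(dvdn_leq n_gt0); rewrite leqNgt lt_nq.
Qed.

Lemma bigOmegaM (n m : nat) :
  0 < n -> 0 < m -> bigOmega (n * m) = bigOmega n + bigOmega m.
Proof.
move=> n_gt0 m_gt0; rewrite !(@bigOmega_widen _ (n * m)) ?muln_gt0 ?n_gt0 ?m_gt0 ?leqnn //=.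
- by rewrite -big_split; apply: eq_bigr => q _; rewrite lognM.
- by rewrite leq_pmull.
- by rewrite leq_pmulr.
Qed.

Lemma bigOmegaX (m n : nat) : 0 < m -> bigOmega (m ^ n) = n * bigOmega m.
Proof.
move=> m_gt0; elim: n => [|n IHn].
  by rewrite mul0n /bigOmega big1 // => q _; rewrite logn1.
by rewrite expnS bigOmegaM ?expn_gt0 ?m_gt0 // IHn mulSn.
Qed.

Lemma bigOmega_gt0 (n : nat) : 1 < n -> 0 < bigOmega n.
Proof.
move=> n_gt1; have n_gt0 := ltnW n_gt1.
have lt_pn : pdiv n < n.+1 by rewrite ltnS pdiv_leq.
rewrite /bigOmega (bigD1 (Ordinal lt_pn)) //= addn_gt0 logn_gt0.
by rewrite mem_primes pdiv_prime // pdiv_dvd n_gt0.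
Qed.

Lemma nonprincipal_gt1 (p : set_system posN) :
  UltraFilter p -> ~ principalN p -> p [set k | 1 < sval k].
Proof.
move=> pU p_np.
have [p1 | p_n1] := in_ultra_setVsetC [set k : posN | sval k = 1] pU; last first.
  apply: filterS p_n1 => -[k k_gt0] /= k_n1.
  by rewrite ltn_neqAle k_gt0 andbT eq_sym; apply/eqP.
case: p_np; exists (exist _ 1 (isT : 0 < 1)) => //.
(* The principal filter at 1 is maximal, so its inclusion in [p] is an equality. *)
apply/esym/(@max_filter _ _ (principal_filter_ultra _)) => A /principal_filterP A1.
apply: filterS p1 => k /= k1.
by rewrite (_ : k = exist _ 1 (isT : 0 < 1)) //; apply: val_inj.
Qed.

Theorem theorem2p32 :
  ~ exists p : set_system posN,
      (betaN `\` principalN) p /\ odot p p = p /\ E2 p p = p.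
Proof.
case=> p [[pU p_np] [p_odot p_E2]].
have p_gt1 := nonprincipal_gt1 _ pU p_np.
have pF : ProperFilter p := @ultra_proper _ _ pU.
pose Om (k : posN) := bigOmega (sval k).
have u_ultra A : fmap Om p A \/ fmap Om p (~` A).
  exact: (in_ultra_setVsetC (Om @^-1` A)).
have u_gt0 : fmap Om p [set x | 0 < x].
  by rewrite /fmap /=; apply: filterS p_gt1 => k; apply: bigOmega_gt0.
apply: (no_mul_absorbing_add_idem _ _ u_ultra _ u_gt0 _ _ sval pF p_gt1) => A.
- rewrite /fmap /= -{1}p_odot.
  apply: (@filterS _ p) => n; apply: (@filterS _ p) => m /=.
  by rewrite /Om /= bigOmegaM ?(svalP n) ?(svalP m).
- rewrite /fmap /= -{1}p_E2.
  apply: (@filterS _ p) => n; apply: (@filterS _ p) => m /=.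
  by rewrite /Om /= bigOmegaX ?(svalP m).
Qed.
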